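(* For any wheel $W_n$ of order $n\geq 4$, $\gamma_{\times 2R}(W_n)=\left\lceil\frac{2(n-1)}{3}\right\rceil+2$.
   Context: For a finite simple graph $G=(V,E)$ with minimum degree at least $1$, a Roman $2$-tuple dominating function on $G$ is a function $f\colon V\to\{0,1,2\}$ such that every vertex $v$ with $f(v)=0$ has at least $2$ neighbors $w$ with $f(w)=2$, and every vertex $v$ with $f(v)\neq 0$ has at least $1$ neighbor $w$ with $f(w)=2$. The weight of $f$ is $f(V)=\sum_{v\in V}f(v)$, and $\gamma_{\times 2R}(G)$ is the minimum weight of a Roman $2$-tuple dominating function on $G$. The wheel $W_n$ of order $n\geq 4$ has vertex set $\{v_0,v_1,\dots,v_{n-1}\}$, where $v_1,\dots,v_{n-1}$ form a cycle of length $n-1$ in this cyclic order and $v_0$ is adjacent to all of $v_1,\dots,v_{n-1}$. *)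

(* Defs.v *)
From HB Require Import structures.
From mathcomp Require Import all_boot all_order all_algebra.
Set Implicit Arguments.
Unset Strict Implicit.
Unset Printing Implicit Defensive.

Record sgraph := SGraph {
  vertex :> finType;
  adj : rel vertex;
  adj_sym : symmetric adj;
  adj_irrefl : irreflexive adj
}.

Definition min_degree_ge1 (G : sgraph) : Prop :=
  forall v : G, 0 < #|[set w | adj v w]|.

Section RomanTwoTuple.
Variable G : sgraph.
Implicit Type f : {ffun G -> 'I_3}.

Definition nbrs2 f (v : G) : {set G} := [set w | adj v w & val (f w) == 2].

Definition roman2tuple f : bool :=
  [forall v : G, if val (f v) == 0 then 2 <= #|nbrs2 f v| else 1 <= #|nbrs2 f v|].

Definition weight f : nat := \sum_(v : G) val (f v).

(* The default of the arg min is the constant function 2, which is a Roman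
   2-tuple dominating function exactly when the minimum degree is at least 1;
   on other graphs no such function exists and the value is meaningless. *)
Definition const2 : {ffun G -> 'I_3} := [ffun=> ord_max].

Definition gamma_x2R : nat :=
  weight [arg min_(f < const2 | roman2tuple f) weight f].

Lemma roman2tuple_const2 : min_degree_ge1 G -> roman2tuple const2.
Proof.
move=> dG; apply/forallP=> v; rewrite ffunE /=.
rewrite (_ : nbrs2 _ _ = [set w | adj v w]) ?dG //.
by apply/setP=> w; rewrite !inE ffunE andbT.
Qed.

Lemma gamma_x2R_min : min_degree_ge1 G ->
  (exists2 f, roman2tuple f & weight f = gamma_x2R) /\
  (forall f, roman2tuple f -> gamma_x2R <= weight f).
Proof.
move=> dG; rewrite /gamma_x2R.
by case: arg_minnP => [|f rf minf]; [exact: roman2tuple_const2 | split; first exists f].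
Qed.

End RomanTwoTuple.

(* Successor of v_i in the cyclic order v_1, ..., v_(n-1). *)
Definition rim_next (n i : nat) : nat := if i.+1 == n then 1 else i.+1.

(* The conjunct i != j only excludes loops: at the hub, and at the rim when
   n = 2. *)
Definition wheel_adj (n : nat) : rel 'I_n := fun i j =>
  (i != j) && [|| val i == 0, val j == 0,
                  val j == rim_next n i | val i == rim_next n j].

Lemma wheel_adj_sym n : symmetric (@wheel_adj n).
Proof.
move=> i j; rewrite /wheel_adj eq_sym; congr (_ && _).
by rewrite orbCA; do 2 congr (_ || _); rewrite orbC.
Qed.

Lemma wheel_adj_irrefl n : irreflexive (@wheel_adj n).
Proof. by move=> i; rewrite /wheel_adj eqxx. Qed.

Definition wheel (n : nat) : sgraph :=
  SGraph (@wheel_adj_sym n) (@wheel_adj_irrefl n).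

Lemma wheel_min_degree n : 1 < n -> min_degree_ge1 (wheel n).
Proof.
case: n => [|[|n]] // _ v; apply/card_gt0P.
have [v0 | v0] := eqVneq v (ord0 : 'I_n.+2).
  by exists (ord_max : 'I_n.+2); rewrite inE v0.
by exists (ord0 : 'I_n.+2); rewrite inE /= /wheel_adj v0 orbT.
Qed.

(* Main.v *)
(** Lower bound: write N0, N1, N2 for the numbers of rim vertices of value
    0, 1, 2, so that m = n - 1 = N0 + N1 + N2.  Summing the domination
    conditions over the rim, where each vertex has two rim neighbours besides
    the hub, gives m + N0 <= b m + 2 N2 with b the indicator of "the hub has
    value 2".  If b = 1 then N0 <= 2 N2 and 3 (2 N2 + N1) >= 2 m.  If b = 0
    then the rim weighs at least m + N0 + N1, which is enough since m >= 3,
    except when N0 = N1 = 0, and then the rim weighs 2 m.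
    Upper bound: give the hub 2, cut the rim into floor (m / 3) blocks 0 2 0,
    and give 1 to the remaining m mod 3 vertices. *)
Require Import Defs.
From HB Require Import structures.
From mathcomp Require Import all_boot all_order all_algebra.
From mathcomp Require Import zify lra.
Set Implicit Arguments.
Unset Strict Implicit.
Unset Printing Implicit Defensive.
Import Order.TTheory GRing.Theory Num.Theory.
Local Open Scope ring_scope.

Definition rim_prev (n i : nat) : nat := if i == 1%N then n.-1 else i.-1.

(** [rim_next] permutes the rim, with inverse [rim_prev]; the only wrap-around term is split off. *)
Lemma sum_rim_next (n : nat) (F : nat -> nat) : (1 < n)%N ->
  (\sum_(1 <= i < n) F (rim_next n i) = \sum_(1 <= i < n) F i)%N.
Proof.
case: n => [|[|n]] // _; rewrite big_nat_recr //= [RHS]big_ltn // addnC.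
rewrite {1}/rim_next eqxx [in RHS]big_add1 /=; congr addn.
apply: eq_big_nat => i /andP[_ lt_in].
by rewrite /rim_next eqSS ltn_eqF.
Qed.

Lemma sum_rim_prev (n : nat) (F : nat -> nat) : (1 < n)%N ->
  (\sum_(1 <= i < n) F (rim_prev n i) = \sum_(1 <= i < n) F i)%N.
Proof.
case: n => [|[|n]] // _; rewrite [RHS]big_nat_recr //= [LHS]big_ltn // addnC.
congr addn; rewrite big_add1 /=.
by apply: eq_big_nat => -[|i].
Qed.

(** Rim vertices are addressed by natural numbers through [inord], so that cyclic shifts become
    reindexings of interval sums. *)
Lemma sum_wheel (m : nat) (F : 'I_m.+1 -> nat) :
  (\sum_(v < m.+1) F v = F ord0 + \sum_(1 <= i < m.+1) F (inord i))%N.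
Proof.
rewrite -(inord_val ord0) -(@big_ltn _ _ _ 0 m.+1 (fun i => F (inord i))) //.
by rewrite big_mkord; apply: eq_bigr => i _; rewrite inord_val.
Qed.

(** The neighbours of value 2 lie in a union of three sets, each a singleton or empty. Equality can
    fail for [m <= 2], where predecessor and successor coincide. *)
Lemma card_nbrs2_rim (m : nat) (f : {ffun wheel m.+1 -> 'I_3}) (i : nat) :
  (0 < i < m.+1)%N ->
  (#|nbrs2 f (inord i : 'I_m.+1)| <= (val (f (ord0 : 'I_m.+1)) == 2%N)
     + ((val (f (inord (rim_prev m.+1 i) : 'I_m.+1)) == 2%N)
     + (val (f (inord (rim_next m.+1 i) : 'I_m.+1)) == 2%N)))%N.
Proof.
move=> /andP[i_gt0 lt_im].
pose B (x : wheel m.+1) : {set wheel m.+1} :=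
  if val (f x) == 2%N then [set x] else set0.
have cardB x : #|B x| = (val (f x) == 2%N).
  by rewrite /B; case: ifP; rewrite ?cards1 ?cards0.
have memB x : val (f x) == 2%N -> x \in B x by move=> fx; rewrite /B fx set11.
set p : wheel m.+1 := inord (rim_prev _ _).
set q : wheel m.+1 := inord (rim_next _ _).
pose z : wheel m.+1 := (ord0 : 'I_m.+1).
rewrite -/z -(cardB z) -(cardB p) -(cardB q).
apply: (@leq_trans #|B z :|: (B p :|: B q)|); last first.
  apply: leq_trans (leq_card_setU _ _) _.
  by rewrite leq_add2l leq_card_setU.
apply/subset_leq_card/subsetP => w; rewrite !inE => /andP[adjw fw].
suff: [|| w == z, w == p | w == q].
  by case/or3P => /eqP <-; rewrite (memB w) ?orbT.
case/andP: adjw => _; rewrite /= inordK // -!val_eqE /= eqn0Ngt i_gt0 /=.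
have := ltn_ord w; rewrite /p /q /rim_prev /rim_next => lt_wm.
by case/or3P => [->//|/eqP ew|/eqP ew];
  rewrite !inordK; move: ew; do ?case: ifP; lia.
Qed.

Lemma rim_count (m : nat) (f : {ffun wheel m.+1 -> 'I_3}) :
  (0 < m)%N -> roman2tuple f ->
  (m + \sum_(1 <= i < m.+1) (val (f (inord i : 'I_m.+1)) == 0%N)
   <= (val (f (ord0 : 'I_m.+1)) == 2%N) * m
      + 2 * \sum_(1 <= i < m.+1) (val (f (inord i : 'I_m.+1)) == 2%N))%N.
Proof.
move=> m_gt0 /forallP rf.
pose c (k i : nat) : nat := val (f (inord i : 'I_m.+1)) == k.
(* Each rim vertex of value 2 serves once as a predecessor and once as a successor. *)
have -> : (2 * \sum_(1 <= i < m.+1) c 2 i = \sum_(1 <= i < m.+1)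
    (c 2 (rim_prev m.+1 i) + c 2 (rim_next m.+1 i)))%N.
  by rewrite big_split /= (sum_rim_prev (c 2)) // (sum_rim_next (c 2)) // mul2n
             addnn.
have cst k : (\sum_(1 <= i < m.+1) k = k * m)%N.
  by rewrite sum_nat_const_nat subn1 mulnC.
rewrite -{1}[m]mul1n -!cst -!big_split /= !big_nat.
apply: leq_sum => i ib; apply: leq_trans (card_nbrs2_rim f ib).
by have := rf (inord i : 'I_m.+1); rewrite /c; case: ifP.
Qed.

(** The factor 3 clears the ceiling and keeps the bound in [nat], within reach of [lia]. *)
Lemma weight_wheel_ge (m : nat) (f : {ffun wheel m.+1 -> 'I_3}) :
  (3 <= m)%N -> roman2tuple f -> (2 * m + 6 <= 3 * weight f)%N.
Proof.
move=> m_ge3 rf; pose c (k i : nat) : nat := val (f (inord i : 'I_m.+1)) == k.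
have -> : weight f = (val (f (ord0 : 'I_m.+1))
    + (2 * \sum_(1 <= i < m.+1) c 2 i + \sum_(1 <= i < m.+1) c 1 i))%N.
  rewrite /weight sum_wheel big_distrr -big_split /=; congr addn.
  by apply: eq_bigr => i _; rewrite /c; case: (f _) => [[|[|[|]]]].
have : (\sum_(1 <= i < m.+1) c 0 i
        + (\sum_(1 <= i < m.+1) c 1 i + \sum_(1 <= i < m.+1) c 2 i) = m)%N.
  rewrite -!big_split /= -[RHS]muln1 -[X in (X * _)%N](subn1 m.+1).
  rewrite -sum_nat_const_nat; apply: eq_bigr => i _.
  by rewrite /c; case: (f _) => [[|[|[|]]]].
have : (m + \sum_(1 <= i < m.+1) c 0 i
        <= (val (f (ord0 : 'I_m.+1)) == 2%N) * m
           + 2 * \sum_(1 <= i < m.+1) c 2 i)%N.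
  exact: rim_count (ltnW (ltnW m_ge3)) rf.
by case: eqP => [->|_] /=; rewrite ?mul1n ?mul0n; lia.
Qed.

(** Blocks are 3k+1, 3k+2, 3k+3, so the middle of a block is the index congruent to 2 modulo 3; the
    leftover vertices come last. *)
Definition wheel_val (m i : nat) : nat :=
  if i == 0%N then 2 else if (3 * (m %/ 3) < i)%N then 1
  else if (i %% 3 == 2)%N then 2 else 0.

Lemma wheel_val_lt3 (m i : nat) : (wheel_val m i < 3)%N.
Proof. by rewrite /wheel_val; do 3?case: ifP. Qed.

Definition wheel_fun (m : nat) : {ffun wheel m.+1 -> 'I_3} :=
  [ffun i : 'I_m.+1 => Ordinal (wheel_val_lt3 m i)].

Lemma roman2tuple_wheel_fun (m : nat) :
  (3 <= m)%N -> roman2tuple (wheel_fun m).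
Proof.
move=> m_ge3; pose z : wheel m.+1 := (ord0 : 'I_m.+1).
have fE (v : wheel m.+1) : val (wheel_fun m v) = wheel_val m (val v).
  by rewrite ffunE.
have z_nbr (v : wheel m.+1) : v != z -> z \in nbrs2 (wheel_fun m) v.
  by move=> vz; rewrite inE fE /= /wheel_adj vz orbT.
(* Here [j] is the middle of a full block, so both its rim neighbours lie in that block and no
   wrap-around occurs. *)
have nbr2 (v : wheel m.+1) (j : nat) : (0 < j <= 3 * (m %/ 3))%N ->
    (j %% 3 = 2)%N -> val v != j ->
    [|| val v == 0%N, j == (val v).+1 | val v == j.+1] ->
    (inord j : 'I_m.+1) \in nbrs2 (wheel_fun m) v.
  move=> jb j3 vj adjvj; have jm : (j < m.+1)%N by lia.
  rewrite inE fE /= /wheel_adj -!val_eqE /= !inordK // /rim_next /wheel_val j3.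
  move: vj adjvj (ltn_ord v) => /=; move: (nat_of_ord v) => x.
  by do ?case: ifP; lia.
apply/forallP => v; rewrite fE.
have [->|vz] := eqVneq v z.
  (* The hub sees the middle of the first block, which exists since [m >= 3]. *)
  rewrite /wheel_val /=; apply/card_gt0P; exists (inord 2 : 'I_m.+1).
  by apply: nbr2 => //=; lia.
case: ifP => [fv|_]; last by apply/card_gt0P; exists z; exact: z_nbr.
have v_gt0 : (0 < val v)%N.
  by rewrite lt0n; apply: contraNneq vz => v0; apply/eqP/val_inj.
(* A rim vertex of value 0 is the first or the last of its block; [j] is the middle. *)
pose j := (if val v %% 3 == 1 then (val v).+1 else (val v).-1)%N.
have [jb j3 vj adjvj] : [/\ (0 < j <= 3 * (m %/ 3))%N, (j %% 3 = 2)%N,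
    val v != j & [|| val v == 0%N, j == (val v).+1 | val v == j.+1]].
  move: fv v_gt0; rewrite /j /wheel_val; move: (val v : nat) => x.
  by do 3?[case: ifP => // ?]; move=> _ _; case: ifP => ?; split; lia.
(* The hub is one neighbour of value 2; [j] supplies another. *)
rewrite (cardsD1 z) z_nbr // add1n ltnS; apply/card_gt0P.
exists (inord j : 'I_m.+1); rewrite in_setD1 nbr2 // andbT.
rewrite -val_eqE /= inordK; lia.
Qed.

Lemma weight_wheel_fun (m : nat) :
  weight (wheel_fun m) = (2 + (2 * (m %/ 3) + m %% 3))%N.
Proof.
rewrite /weight sum_wheel ffunE; congr addn.
transitivity (\sum_(1 <= i < m.+1) wheel_val m i)%N.
  by apply: eq_big_nat => i /andP[_ im]; rewrite ffunE /= inordK.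
rewrite (big_cat_nat (n := (3 * (m %/ 3)).+1)) //=; last by lia.
congr addn.
  transitivity (\sum_(1 <= i < (3 * (m %/ 3)).+1)
      if i %% 3 == 2 then 2 else 0)%N.
    apply: eq_big_nat => i /andP[i_gt0 ib].
    by rewrite /wheel_val gtn_eqF // ltnNge -ltnS ib.
  (* Each further block adds 0 + 2 + 0. *)
  elim: (m %/ 3)%N => [|k IHk]; first by rewrite big_geq.
  rewrite mulnS !addSn add0n; do 3![rewrite big_nat_recr //=]; rewrite IHk.
  by do ?case: eqP; lia.
transitivity (\sum_((3 * (m %/ 3)).+1 <= i < m.+1) 1)%N.
  by apply: eq_big_nat => i /andP[ib _]; rewrite /wheel_val ib gtn_eqF //; lia.
by rewrite sum_nat_const_nat; lia.
Qed.

Theorem proposition11 (n : nat) (hn : (4 <= n)%N) :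
  (gamma_x2R (wheel n))%:Z = Num.ceil (2 * (n%:R - 1) / 3 : rat) + 2.
Proof.
case: n hn => // m m_ge3.
have [[f rf fw] min_g] :=
  gamma_x2R_min (@wheel_min_degree m.+1 (ltnW (ltnW m_ge3))).
have lb := weight_wheel_ge m_ge3 rf; rewrite fw in lb.
have ub := min_g _ (roman2tuple_wheel_fun m_ge3).
rewrite weight_wheel_fun in ub.
move: (gamma_x2R _) lb ub => g lb ub.
apply/eqP; rewrite -subr_eq eq_sym; apply/eqP/ceil_def.
have lbQ : (2 * m%:R + 6 <= 3 * g%:R :> rat) by rewrite -!natrM -natrD ler_nat.
(* With r = m mod 3, three times the weight of [wheel_fun m] is 2m + 6 + r, and r < 3. *)
have ubQ : (3 * g%:R < 2 * m%:R + 9 :> rat).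
  by rewrite -!natrM -natrD ltr_nat; lia.
rewrite -natr1 !intrB /=; apply/andP; split; rewrite -?pmulrn; lra.
Qed.
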